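(* For any permutation $\pi$ of $[n]$, the inversion graph $G_{\pi}$ has lettericity at most $\lceil n/2 \rceil$.
   Context: For a permutation $\pi$ of $[n]=\{1,\dots,n\}$, an inversion is a pair of indices $(i,j)$ with $i<j$ and $\pi(i)>\pi(j)$. The inversion graph $G_\pi$ is the graph with vertex set $[n]$ and edge set $\{\pi(i)\pi(j): i<j,\ \pi(i)>\pi(j)\}$. Given a finite alphabet $\Sigma$, a decoder is a set of ordered pairs $D\subseteq\Sigma^2$. For a word $w$ with letters $w(1),\dots,w(n)\in\Sigma$, the letter graph $\Gamma_D(w)$ is the graph with vertex set $\{1,\dots,n\}$ and with an edge $ij$ for each $i<j$ such that $(w(i),w(j))\in D$. If $|\Sigma|=k$, then $\Gamma_D(w)$ is called a $k$-letter graph. The lettericity of a graph $G$ is the least integer $k$ such that $G$ is isomorphic to a $k$-letter graph. *)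

(* Defs.v *)
From mathcomp Require Import all_boot all_fingroup.
From mathcomp Require Import boolp.

Set Implicit Arguments.
Unset Strict Implicit.
Unset Printing Implicit Defensive.

Record sgraph := SGraph {
  vertex :> finType;
  edge : rel vertex;
  edge_sym : symmetric edge;
  edge_irrefl : irreflexive edge }.

Definition graph_iso (G H : sgraph) : Prop :=
  exists2 f : G -> H, bijective f & {mono f : x y / edge x y}.

Section InversionGraph.
Variables (n : nat) (pi : 'S_n).

(* [n] is encoded as 'I_n = {0, ..., n-1}. *)
Definition inversion (i j : 'I_n) : bool := (i < j) && (pi j < pi i).

(* Vertices are values: i and j below are positions. *)
Definition inversion_edge : rel 'I_n := fun u v =>
  [exists i, exists j, inversion i j && ([set u; v] == [set pi i; pi j])].

Lemma inversion_edge_sym : symmetric inversion_edge.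
Proof. by move=> u v; rewrite /inversion_edge setUC. Qed.

Lemma inversion_edge_irrefl : irreflexive inversion_edge.
Proof.
move=> u; apply/existsP => -[i /existsP[j /andP[/andP[_ ltji] /eqP uuE]]].
have: pi i \in [set u; u] by rewrite uuE set21.
have: pi j \in [set u; u] by rewrite uuE set22.
by rewrite setUid !inE => /eqP pij /eqP pii; rewrite pij pii ltnn in ltji.
Qed.

Definition inversion_graph : sgraph :=
  SGraph inversion_edge_sym inversion_edge_irrefl.

End InversionGraph.

Section LetterGraph.
Variables (Sigma : finType) (D : {set Sigma * Sigma}).
Variables (n : nat) (w : n.-tuple Sigma).

Definition letter_edge : rel 'I_n := fun i j =>
  ((i < j) && ((tnth w i, tnth w j) \in D))
  || ((j < i) && ((tnth w j, tnth w i) \in D)).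

Lemma letter_edge_sym : symmetric letter_edge.
Proof. by move=> i j; rewrite /letter_edge orbC. Qed.

Lemma letter_edge_irrefl : irreflexive letter_edge.
Proof. by move=> i; rewrite /letter_edge ltnn. Qed.

Definition letter_graph : sgraph := SGraph letter_edge_sym letter_edge_irrefl.

End LetterGraph.

Definition iso_k_letter_graph (G : sgraph) (k : nat) : Prop :=
  exists (Sigma : finType) (D : {set Sigma * Sigma}) (n : nat)
         (w : n.-tuple Sigma),
    #|Sigma| = k /\ graph_iso G (letter_graph D w).

Lemma ex_iso_k_letter_graph (G : sgraph) :
  exists k, `[< iso_k_letter_graph G k >].
Proof.
exists #|G|; apply/asboolP.
exists G, [set p | edge p.1 p.2], #|G|, [tuple enum_val i | i < #|G|].
split=> //; exists enum_rank; first exact: enum_rank_bij.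
move=> x y; rewrite /= /letter_edge !tnth_mktuple !enum_rankK !inE /=.
rewrite (edge_sym y x).
case: ltngtP => [||/val_inj/enum_rank_inj->]; rewrite ?orbF ?edge_irrefl //.
Qed.

Definition lettericity (G : sgraph) : nat := ex_minn (ex_iso_k_letter_graph G).

(* Main.v *)
Require Import Defs.
From mathcomp Require Import all_boot all_fingroup.
From mathcomp Require Import boolp zify.

Set Implicit Arguments.
Unset Strict Implicit.
Unset Printing Implicit Defensive.

(** Write [pi] in one-line notation and replace each value [v] by the letter
    [v./2].  Two entries carrying distinct letters form an inversion exactly when
    the larger letter comes first, and each letter occurs at most twice, so
    whether its two occurrences are inverted can be recorded in the decoder. *)

Lemma lettericity_leq (G : sgraph) (k : nat) :
  iso_k_letter_graph G k -> lettericity G <= k.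
Proof.
rewrite /lettericity; case: ex_minnP => m _ min_m Gk.
by apply: min_m; apply/asboolP.
Qed.

(** Transfers adjacency from values to positions, which index the vertices of a letter graph. *)
Lemma inversion_edge_perm (n : nat) (pi : 'S_n) (i j : 'I_n) :
  inversion_edge pi (pi i) (pi j) = inversion pi i j || inversion pi j i.
Proof.
have [->|ne_ij] := eqVneq i j.
  by rewrite inversion_edge_irrefl /inversion ltnn.
apply/existsP/orP => [[i' /existsP[j' /andP[inv_ij' /eqP eq_ij]]]|].
  have: pi j \in [set pi i'; pi j'] by rewrite -eq_ij set22.
  have: pi i \in [set pi i'; pi j'] by rewrite -eq_ij set21.
  rewrite !inE !(inj_eq perm_inj).
  case/orP=> /eqP eq_i /orP[]/eqP eq_j; move: ne_ij; rewrite eq_i eq_j ?eqxx //.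
    by left.
  by right.
case=> inv_ij; [exists i | exists j]; apply/existsP;
  [exists j | exists i]; by rewrite inv_ij ?eqxx // setUC eqxx.
Qed.

Lemma half_ord_subproof (n : nat) (v : 'I_n) : v./2 < uphalf n.
Proof. have := ltn_ord v; lia. Qed.

Definition half_ord (n : nat) (v : 'I_n) : 'I_(uphalf n) :=
  Ordinal (half_ord_subproof v).

Definition half_word (n : nat) (pi : 'S_n) : n.-tuple 'I_(uphalf n) :=
  [tuple half_ord (pi i) | i < n].

(** An inversion never puts the smaller letter first, so beyond the first disjunct the second adds
    only diagonal pairs: the letters whose two occurrences are inverted. *)
Definition half_decoder (n : nat) (pi : 'S_n) : {set _} :=
  [set p : 'I_(uphalf n) * 'I_(uphalf n) | (p.2 < p.1) || [exists i, exists j,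
    [&& inversion pi i j, half_ord (pi i) == p.1 & half_ord (pi j) == p.2]]].

Lemma half_decoderP (n : nat) (pi : 'S_n) (i j : 'I_n) : i < j ->
  ((half_ord (pi i), half_ord (pi j)) \in half_decoder pi) = (pi j < pi i).
Proof.
move=> ltij; rewrite inE /=; apply/orP/idP => [[|]|gt_ij]; first by lia.
  case/existsP=> i' /existsP[j' /and3P[/andP[lt_ij' gt_ij'] /eqP[hi] /eqP[hj]]].
  rewrite ltnNge; apply/negP => le_ij.
  have ne_ij: (pi i : nat) != pi j.
    by rewrite val_eqE (inj_eq perm_inj) neq_ltn ltij.
  (* Here [pi i < pi j] and [pi j' < pi i'], and the letters force all four values to have the same
     half. Only two values share a half, so the pairs coincide crosswise, against [i < j] and
     [i' < j']. *)
  have eq_ij' : i = j' by apply/(@perm_inj _ pi)/val_inj => /=; lia.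
  have eq_ji' : j = i' by apply/(@perm_inj _ pi)/val_inj => /=; lia.
  by move: lt_ij'; rewrite -eq_ij' -eq_ji' ltnNge ltnW.
by right; apply/existsP; exists i; apply/existsP; exists j;
  rewrite /inversion ltij gt_ij !eqxx.
Qed.

Theorem theorem3p3p1 (n : nat) (pi : 'S_n) :
  lettericity (inversion_graph pi) <= uphalf n.
Proof.
apply: lettericity_leq.
exists 'I_(uphalf n), (half_decoder pi), n, (half_word pi).
split; first exact: card_ord.
(* The isomorphism sends each value to its position. *)
exists (pi^-1)%g; first by exists pi => v; rewrite ?permKV ?permK.
move=> u v; rewrite -[u in RHS](permKV pi) -[v in RHS](permKV pi).
move: ((pi^-1)%g u) ((pi^-1)%g v) => i j.
rewrite /= inversion_edge_perm /letter_edge /inversion !tnth_mktuple.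
by congr (_ || _); apply: andb_id2l => /half_decoderP ->.
Qed.
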